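(* Let $(X,d)$ be a complete CAT$(0)$ space, let $f,g:X\to(-\infty,\infty]$ be convex, lower semi-continuous and proper, and let $\lambda>0$. Suppose that the problem of minimizing $$\Phi(x,y):=f(x)+g(y)+\frac1{2\lambda}d(x,y)^2$$ over $(x,y)\in X\times X$ has a solution. Let $(\varepsilon_n)$ and $(\delta_n)$ be sequences of nonnegative reals with $\sum_{n=0}^\infty\varepsilon_n<\infty$ and $\sum_{n=0}^\infty\delta_n<\infty$. Given $x_0\in X$, let $(x_n)$ (starting at $x_0$) and $(y_n)$ be any sequences in $X$ satisfying $$d(y_n,J_\lambda^gx_n)\le\varepsilon_n\quad\text{and}\quad d(x_{n+1},J_\lambda^fy_n)\le\delta_n\quad\text{for each }n\in\mathbb{N}.$$ Then there exists $u\in X$ such that $(u,J_\lambda^gu)$ is a minimizer of $\Phi$ over $X\times X$ and $(x_n)$ and $(y_n)$ $\Delta$-converge to $u$ and $J_\lambda^gu$, respectively.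
   Context: $\mathbb{N}=\{0,1,2,\ldots\}$. A CAT$(0)$ space is a geodesic space of nonpositive curvature in the sense of Alexandrov. A function $h:X\to(-\infty,\infty]$ is convex iff it is convex along geodesics, and proper iff it is not constantly $+\infty$. For $h$ convex, lower semi-continuous and proper on a complete CAT$(0)$ space and $\lambda>0$, the resolvent $J_\lambda^h(x)$ is the unique minimizer over $z\in X$ of $h(z)+\frac1{2\lambda}d(x,z)^2$. For a bounded sequence $(x_n)$ in $X$, an asymptotic center is a point $x\in X$ with $\limsup_n d(x,x_n)=\inf_{y\in X}\limsup_n d(y,x_n)$. A bounded sequence $(x_n)$ $\Delta$-converges to $x\in X$ iff $x$ is the unique asymptotic center of every subsequence of $(x_n)$. *)

(* Defs.v *)
From HB Require Import structures.
From mathcomp Require Import all_boot all_order all_algebra.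
From mathcomp Require Import all_classical all_reals all_analysis.

Set Implicit Arguments.
Unset Strict Implicit.
Unset Printing Implicit Defensive.

Import Order.TTheory GRing.Theory Num.Theory.
Import numFieldNormedType.Exports.

Local Open Scope classical_set_scope.
Local Open Scope ring_scope.

(* The library norm on 'rV[R]_2 is the sup norm, hence an explicit Euclidean
   distance. *)
Definition euclid_dist (R : realType) (a b : 'rV[R]_2) : R :=
  Num.sqrt (\sum_(i < 2) (a 0 i - b 0 i) ^+ 2).

Section CAT0.
Context (R : realType) (X : metricType R).

(* Cauchy sequences rather than cauchy_cvg: completeType also requires a
   distinguished point. *)
Definition complete_metric :=
  forall u : nat -> X, cauchy (u @ \oo) -> exists l : X, u @ \oo --> l.

(* Geodesics are parametrized on [0, 1] proportionally to arc length; the values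
   of c outside [0, 1] are irrelevant. *)
Definition geodesic (c : R -> X) (x y : X) :=
  [/\ c 0 = x, c 1 = y &
      forall s t : R, 0 <= s <= 1 -> 0 <= t <= 1 ->
        mdist (c s) (c t) = `|s - t| * mdist x y].

Definition geodesic_space := forall x y : X, exists c, geodesic c x y.

(* v : vertices; c i : side from v i to v (i + 1 mod 3). *)
Definition geodesic_triangle (v : 'I_3 -> X) (c : 'I_3 -> R -> X) :=
  forall i, geodesic (c i) (v i) (v (ordS i)).

Definition comparison_triangle (v : 'I_3 -> X) (w : 'I_3 -> 'rV[R]_2) :=
  forall i, euclid_dist (w i) (w (ordS i)) = mdist (v i) (v (ordS i)).

(* The comparison point of c i s. *)
Definition comparison_point (w : 'I_3 -> 'rV[R]_2) (i : 'I_3) (s : R) :=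
  (1 - s) *: w i + s *: w (ordS i).

Definition CAT0 :=
  geodesic_space /\
  forall v c w, geodesic_triangle v c -> comparison_triangle v w ->
    forall i j (s t : R), 0 <= s <= 1 -> 0 <= t <= 1 ->
      mdist (c i s) (c j t) <=
      euclid_dist (comparison_point w i s) (comparison_point w j t).

End CAT0.

Section functions.
Context (R : realType).
Local Open Scope ereal_scope.

Definition minimizer (T : Type) (F : T -> \bar R) (z : T) :=
  forall y, F z <= F y.

Context (X : metricType R).
Implicit Types (h : X -> \bar R) (u : nat -> X).

Definition convex_fun h :=
  forall x y c, geodesic c x y -> forall t : R, (0 <= t <= 1)%R ->
    h (c t) <= (1 - t)%:E * h x + t%:E * h y.

Definition proper_fun h := exists x, h x != +oo.

(* Takes the junk value x when the unique minimizer does not exist, which does not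
   happen for h convex, lower semicontinuous and proper on a complete CAT(0)
   space. *)
Definition resolvent h (lam : R) (x : X) : X :=
  xget x [set z | unique
    (minimizer (fun z => h z + ((2 * lam)^-1 * mdist x z ^+ 2)%:E)) z].

Definition bounded_sequence u :=
  exists (a : X) (M : R), forall n, (mdist a (u n) <= M)%R.

Definition limsup_dist u (y : X) : \bar R :=
  limn_esup (fun n => (mdist y (u n))%:E).

Definition asymptotic_center u (x : X) :=
  limsup_dist u x = ereal_inf (range (limsup_dist u)).

Definition Delta_cvg u (x : X) :=
  bounded_sequence u /\
  forall phi : nat -> nat, increasing_seq phi ->
    unique (asymptotic_center (u \o phi)) x.

End functions.

(* Main.v *)
Require Import Defs.
From mathcomp Require Import all_boot all_order all_algebra.
From mathcomp Require Import all_classical all_reals all_analysis.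
From mathcomp Require Import ring lra.

(** Write k = 1/(2 lam), Jf and Jg for the two resolvents and T = Jf Jg.

    A minimizer (p, q) of Phi bounds f(x) and g(y) below by a constant minus
    k d(x, q)^2, resp. k d(y, p)^2; convexity improves this to an affine bound,
    so that the functions defining the resolvents are bounded below and, being
    strongly convex, have unique minimizers.  The inequality
    h(z) + k d(x, z)^2 + k d(z, w)^2 <= h(w) + k d(x, w)^2 for z = J x, combined
    with the fact that in a CAT(0) quadrilateral the squared diagonals sum to at
    most the squared sides, shows that resolvents are nonexpansive, that the
    fixed points u of T are exactly those for which (u, Jg u) minimizes Phi, and
    that d(T x, T T x)^2 <= d(p, x)^2 - d(p, T x)^2.

    The sequences x and y are orbits of T and Jg Jf up to summable errors.  Hence
    their distances to fixed points converge, and the last inequality yields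
    d(x_n, T x_n) -> 0, so asymptotic centers of subsequences are fixed points;
    as the radius at a fixed point is the same for all subsequences, the centers
    coincide.  The limits match because d(x_n, z) and d(y_n, Jg z) have the same
    limit for every fixed point z of T. *)

Set Implicit Arguments.
Unset Strict Implicit.
Unset Printing Implicit Defensive.

Import Order.TTheory GRing.Theory Num.Theory.
Import numFieldNormedType.Exports.

Local Open Scope classical_set_scope.
Local Open Scope ring_scope.

(** * Euclidean comparison triangles *)

Lemma plane_triangle (R : realType) (a b c : R) :
  0 <= a -> 0 <= b -> 0 <= c -> a <= b + c -> b <= a + c -> c <= a + b ->
  exists p q : R, p ^+ 2 + q ^+ 2 = b ^+ 2 /\ (a - p) ^+ 2 + q ^+ 2 = c ^+ 2.
Proof.
move=> a0 b0 c0 abc bac cab.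
have [a_eq0|a_neq0] := eqVneq a 0.
  by exists b, 0; have <- : b = c by [lra]; split; rewrite ?a_eq0; ring.
have a_gt0 : 0 < a by rewrite lt_neqAle eq_sym a_neq0.
(* The triangle has vertices (0, 0), (a, 0) and (p, q). The law of cosines forces p; a real q needs
   p^2 <= b^2, which amounts to |a - b| <= c <= a + b. *)
pose p := (a ^+ 2 + b ^+ 2 - c ^+ 2) / (2 * a).
have pE : 2 * a * p = a ^+ 2 + b ^+ 2 - c ^+ 2.
  by rewrite /p mulrC divfK // mulf_neq0 ?pnatr_eq0.
have p_le : p ^+ 2 <= b ^+ 2.
  have c_le : c ^+ 2 <= (a + b) ^+ 2 by rewrite lerXn2r ?nnegrE ?addr_ge0.
  have c_ge : (a - b) ^+ 2 <= c ^+ 2.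
    by rewrite -(@ler_sqrt _ _ _ (sqr_ge0 _)) !sqrtr_sqr (ger0_norm c0) ler_norml; lra.
  have p_leb : p <= b.
    by rewrite -(@ler_pM2l _ (2 * a)) ?mulr_gt0 // pE; nra.
  have p_geb : - b <= p.
    by rewrite -(@ler_pM2l _ (2 * a)) ?mulr_gt0 // pE; nra.
  nra.
exists p, (Num.sqrt (b ^+ 2 - p ^+ 2)).
rewrite sqr_sqrtr ?subr_ge0 //; split; first ring.
clearbody p; lra.
Qed.

Lemma euclid_distE (R : realType) (a b : 'rV[R]_2) :
  euclid_dist a b ^+ 2 = (a 0 0 - b 0 0) ^+ 2 + (a 0 1 - b 0 1) ^+ 2.
Proof.
rewrite /euclid_dist sqr_sqrtr ?sumr_ge0 // => [|i _]; last exact: sqr_ge0.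
by rewrite !big_ord_recl big_ord0 addr0; congr (_ + (a 0 _ - b 0 _) ^+ 2);
  exact: val_inj.
Qed.

Lemma euclid_dist_eq (R : realType) (a b : 'rV[R]_2) (r : R) : 0 <= r ->
  (a 0 0 - b 0 0) ^+ 2 + (a 0 1 - b 0 1) ^+ 2 = r ^+ 2 -> euclid_dist a b = r.
Proof.
move=> r0; rewrite -euclid_distE => /eqP.
by rewrite eqrXn2 ?sqrtr_ge0 // => /eqP.
Qed.

(** * Consequences of the CAT(0) condition *)

Section CAT0_geometry.
Context {R : realType} {X : metricType R}.
Hypothesis X_CAT0 : CAT0 X.

(** In the plane this is an equality, Stewart's theorem. The comparison is between the vertex z, as
    the point of parameter 0 on the side from z to x, and a point on the side from x to y. *)
Lemma CAT0_CN (x y : X) (c : R -> X) (z : X) (t : R) :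
  geodesic c x y -> 0 <= t <= 1 ->
  mdist z (c t) ^+ 2 <= (1 - t) * mdist z x ^+ 2 + t * mdist z y ^+ 2
    - t * (1 - t) * mdist x y ^+ 2.
Proof.
move=> cxy t01; have [geo cmp] := X_CAT0.
have [c1 c1P] := geo y z; have [c2 c2P] := geo z x.
have xy_le : mdist x y <= mdist z x + mdist y z.
  by rewrite (metric_sym z x) (metric_sym y z); exact: metric_triangle.
have zx_le : mdist z x <= mdist x y + mdist y z.
  by rewrite (metric_sym z x); exact: metric_triangle.
have yz_le : mdist y z <= mdist x y + mdist z x.
  by rewrite addrC (metric_sym y z); exact: metric_triangle.
have [p [q [pq1 pq2]]] := plane_triangle (mdist_ge0 x y)
  (mdist_ge0 z x) (mdist_ge0 y z) xy_le zx_le yz_le.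
pose v (i : 'I_3) := match val i with 0%N => x | 1%N => y | _ => z end.
pose cc (i : 'I_3) := match val i with 0%N => c | 1%N => c1 | _ => c2 end.
pose w (i : 'I_3) : 'rV[R]_2 := match val i with
  | 0%N => 0
  | 1%N => \row_j (if j == 0 then mdist x y else 0)
  | _ => \row_j (if j == 0 then p else q) end.
have vcP : geodesic_triangle v cc by move=> [[|[|[|//]]] ?].
have vwP : comparison_triangle v w.
  move=> [[|[|[|//]]] ?]; rewrite /v /w /=; apply: euclid_dist_eq;
    rewrite ?mdist_ge0 // !mxE /=; lra.
have := cmp v cc w vcP vwP ord_max ord0 0 t.
rewrite /cc /= lexx ler01 => /(_ isT t01).
have [-> _ _] := c2P => /(lerXn2r 2); rewrite !nnegrE mdist_ge0 sqrtr_ge0.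
move=> /(_ isT isT) /le_trans; apply.
rewrite euclid_distE /comparison_point /w /= !mxE /=.
rewrite (metric_sym z y) -pq1 -pq2 le_eqVlt; apply/orP; left; apply/eqP; ring.
Qed.

Lemma CAT0_midpoint (x y : X) : exists m, forall z : X,
  mdist z m ^+ 2 <= mdist z x ^+ 2 / 2 + mdist z y ^+ 2 / 2 - mdist x y ^+ 2 / 4.
Proof.
have [c cP] := X_CAT0.1 x y.
exists (c 2^-1) => z; apply: le_trans (CAT0_CN z cP _) _; lra.
Qed.

(** Apply the midpoint inequality for a and c at b and at d, and use d(b, d)^2 <= 2 d(b, m)^2 + 2
    d(d, m)^2. *)
Lemma CAT0_quadrilateral (a b c d : X) :
  mdist a c ^+ 2 + mdist b d ^+ 2 <=
  mdist a b ^+ 2 + mdist b c ^+ 2 + mdist c d ^+ 2 + mdist d a ^+ 2.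
Proof.
have [m mP] := CAT0_midpoint a c.
have mb := mP b; have md := mP d.
have tri := metric_triangle b m d.
rewrite (metric_sym b a) in mb; rewrite (metric_sym d c) in md.
rewrite (metric_sym m d) in tri.
have := mdist_ge0 b d; have := mdist_ge0 b m; have := mdist_ge0 d m.
have : (mdist b m - mdist d m) ^+ 2 >= 0 by exact: sqr_ge0.
nra.
Qed.

End CAT0_geometry.

(** * Existence and uniqueness of minimizers *)

Section metric_minimization.
Context {R : realType} {X : metricType R}.

Lemma ler_dist_mdist (a x y : X) : `|mdist a x - mdist a y| <= mdist x y.
Proof.
have := metric_triangle a x y; have := metric_triangle a y x.
rewrite (metric_sym y x) ler_norml; lra.
Qed.

Lemma mdist_continuous (a : X) : continuous (mdist a : X -> R).
Proof.
move=> l; apply/cvgrPdist_lt => e e0.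
apply: filterS (nbhsx_ballx l _ e0) => z; rewrite ballEmdist.
exact: le_lt_trans (ler_dist_mdist a l z).
Qed.

Lemma lte_EFin_between (r : R) (x : \bar R) :
  (r%:E < x)%E -> exists2 a : R, r < a & (a%:E < x)%E.
Proof.
case: x => [x||//]; last by exists (r + 1); rewrite ?ltry //; lra.
by rewrite lte_fin => rx; exists ((r + x) / 2); rewrite ?lte_fin; lra.
Qed.

Lemma lower_semicontinuousD_cts (h : X -> \bar R) (q : X -> R) :
  lower_semicontinuous h -> continuous q ->
  lower_semicontinuous (fun z => (h z + (q z)%:E)%E).
Proof.
move=> h_lsc q_cts l a; rewrite -lteBlDr // -EFinB => /lte_EFin_between[b ab bh].
have [V lV hV] := h_lsc l b bh.
exists (V `&` [set y | a - b < q y]).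
  apply: filterI => //; have := q_cts l; move=> /cvgr_gt; apply; lra.
move=> y [Vy /= qy]; rewrite -lteBlDr // -EFinB; apply: le_lt_trans (hV y Vy).
rewrite lee_fin; lra.
Qed.

(** Serves both resolvents and asymptotic centers. A minimizing sequence is Cauchy, because the
    point z cannot have a value below the infimum; by lower semicontinuity its limit is a minimizer.
    The real bounds [ra] and [rb] stand in for values of [F], which may be infinite. *)
Lemma strongly_midconvex_unique_minimizer (F : X -> \bar R) (m kap : R) :
  complete_metric X -> 0 < kap -> (forall x, m%:E <= F x)%E ->
  (exists x, F x != +oo)%E -> lower_semicontinuous F ->
  (forall (a b : X) (ra rb : R), (F a <= ra%:E)%E -> (F b <= rb%:E)%E ->
    exists z, (F z <= ((ra + rb) / 2 - kap * mdist a b ^+ 2)%:E)%E) ->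
  exists z, unique (minimizer F) z.
Proof.
move=> X_complete kap0 F_ge [x0 Fx0] F_lsc F_mid.
have i_fin : ereal_inf (range F) \is a fin_num.
  rewrite fin_numElt; apply/andP; split.
    apply: (@lt_le_trans _ _ m%:E); first exact: ltNyr.
    by apply: le_ereal_inf_tmp => _ [x _ <-].
  apply: (@le_lt_trans _ _ (F x0)); last by rewrite ltey.
  by apply: ereal_inf_lbound; exists x0.
pose I := fine (ereal_inf (range F)).
have IE : I%:E = ereal_inf (range F) by rewrite /I fineK.
have I_le x : (I%:E <= F x)%E by rewrite IE; apply: ereal_inf_lbound; exists x.
(* Near-minimal points are close; with zero excesses this gives uniqueness. *)
have dist_le (a b : X) (ea eb : R) :
    (F a <= (I + ea)%:E)%E -> (F b <= (I + eb)%:E)%E ->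
    kap * mdist a b ^+ 2 <= (ea + eb) / 2.
  move=> Fa Fb; have [z Fz] := F_mid _ _ _ _ Fa Fb.
  have := le_trans (I_le z) Fz; rewrite lee_fin; lra.
have /choice[u uP] : forall n : nat, exists z, (F z <= (I + n.+1%:R^-1)%:E)%E.
  move=> n; have n0 : 0 < n.+1%:R^-1 :> R by rewrite invr_gt0.
  have [_ [z _ <-]] := lb_ereal_inf_adherent n0 i_fin.
  by rewrite -IE -EFinD => /ltW; exists z.
have inv0 (e : R) : 0 < e -> \forall n \near \oo, n.+1%:R^-1 < e.
  by move=> e0; exact: (near_infty_natSinv_lt (PosNum e0)).
have [l ul] : exists l : X, u @ \oo --> l.
  apply: X_complete.
  suff: forall e : R, 0 < e -> \forall x & y \near u @ \oo, ball x e y.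
    by move=> ?; exact/cauchy_ballP.
  move=> e e0.
  have ke : 0 < kap * e ^+ 2 by rewrite mulr_gt0 ?exprn_gt0.
  pose A := [set u n | n in [set n | n.+1%:R^-1 < kap * e ^+ 2]].
  have uA : \forall n \near \oo, A (u n).
    by apply: filterS (inv0 _ ke) => n ne; exists n.
  exists (A, A) => //=.
  move=> [_ _] [/= [i ie <-] [j je <-]]; rewrite ballEmdist /=.
  move: ie je => /= ie je; have /= := dist_le _ _ _ _ (uP i) (uP j) => d_le.
  have : mdist (u i) (u j) ^+ 2 < e ^+ 2.
    rewrite -(ltr_pM2l kap0); apply: le_lt_trans d_le _.
    by rewrite ltr_pdivrMr // mulrDr mulr1 ltrD.
  by rewrite ltr_pXn2r ?nnegrE ?mdist_ge0 ?(ltW e0).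
have Fl : F l = I%:E.
  apply/eqP; rewrite eq_le I_le andbT leNgt; apply/negP => /lte_EFin_between.
  case=> a Ia aFl; have [V lV FV] := F_lsc l a aFl.
  near \oo => n; have : V (u n) by near: n; exact: ul.
  move=> /FV; apply/negP; rewrite -leNgt; apply: le_trans (uP n) _.
  rewrite lee_fin -lerBrDl ltW //; near: n; apply: inv0; lra.
exists l; split=> [x|l' l'P]; first by rewrite Fl.
have Fl' : F l' = I%:E by apply/eqP; rewrite eq_le I_le -{1}Fl l'P.
have := dist_le l l' 0 0; rewrite !addr0 Fl Fl' mul0r => /(_ (lexx _) (lexx _)).
rewrite pmulr_rle0 // => d_le0; apply: mdist_positivity; apply/eqP.
by rewrite -sqrf_eq0 eq_le d_le0 sqr_ge0.
Unshelve. all: by end_near. Qed.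

End metric_minimization.

(** * Resolvents: variational inequality, nonexpansiveness, existence *)

Section proximal_points.
Context {R : realType} {X : metricType R}.
Hypothesis X_CAT0 : CAT0 X.
Context (k : R).
Hypothesis k_gt0 : 0 < k.

Lemma convex_fun_le (h : X -> \bar R) (a b : X) (c : R -> X) (t ra rb : R) :
  convex_fun h -> geodesic c a b -> 0 <= t <= 1 ->
  (h a <= ra%:E)%E -> (h b <= rb%:E)%E ->
  (h (c t) <= ((1 - t) * ra + t * rb)%:E)%E.
Proof.
move=> h_cvx cab t01 ha hb; apply: le_trans (h_cvx _ _ _ cab t t01) _.
have /andP[t0 t1] := t01.
by rewrite (EFinD ((1 - t) * ra)) !EFinM leeD // lee_wpmul2l // lee_fin // subr_ge0.
Qed.

(* The variational characterisation of the minimizer z of h + k d(x, .)^2. *)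
Definition is_prox (h : X -> \bar R) (x z : X) := exists2 hz : R, h z = hz%:E &
  forall (w : X) (r : R), (h w <= r%:E)%E ->
    hz + k * mdist x z ^+ 2 + k * mdist z w ^+ 2 <= r + k * mdist x w ^+ 2.

(** Compare z with the point [c t] of the geodesic from z to w, divide by t, and let t tend to 0. *)
Lemma minimizer_is_prox (h : X -> \bar R) (x z : X) :
  convex_fun h -> (forall y, -oo < h y)%E -> proper_fun h ->
  minimizer (fun y => (h y + (k * mdist x y ^+ 2)%:E)%E) z -> is_prox h x z.
Proof.
move=> h_cvx h_gtNy [y0 hy0] z_min.
have hz_fin : h z \is a fin_num.
  rewrite fin_numElt h_gtNy /=; have := z_min y0.
  case: (h z) => [r _||]; rewrite ?ltry //= addye // leye_eq.
  by case: (h y0) hy0.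
exists (fine (h z)); first by rewrite fineK.
move: (fine (h z)) (fineK hz_fin) => hz hzE w r hw.
have [c cP] := X_CAT0.1 z w.
have key t : 0 < t < 1 ->
    hz + k * mdist x z ^+ 2 + (1 - t) * (k * mdist z w ^+ 2)
    <= r + k * mdist x w ^+ 2.
  move=> /andP[t0 t1]; have t01 : 0 <= t <= 1 by rewrite !ltW.
  have hct : (h (c t) <= ((1 - t) * hz + t * r)%:E)%E.
    by apply: convex_fun_le h_cvx cP t01 _ hw; rewrite hzE.
  have := le_trans (z_min (c t)) (leeD2r _ hct).
  rewrite -hzE -!EFinD lee_fin => hz_le.
  have := CAT0_CN X_CAT0 x cP t01 => /(ler_wpM2l (ltW k_gt0)) cn.
  rewrite -(ler_pM2l t0); nra.
have B_ge0 : 0 <= k * mdist z w ^+ 2 by rewrite mulr_ge0 ?sqr_ge0 ?ltW.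
(* If the inequality failed by s > 0, [key] would give s <= t B for all t in (0, 1), which t = s /
   (s + B + 1) contradicts. *)
rewrite leNgt; apply/negP => s_gt0.
set B := k * mdist z w ^+ 2 in key B_ge0 s_gt0.
pose s := hz + k * mdist x z ^+ 2 + B - (r + k * mdist x w ^+ 2).
have sB : 0 < s + B + 1 by rewrite /s; lra.
have /key : 0 < s / (s + B + 1) < 1.
  by rewrite divr_gt0 ?ltr_pdivrMr // /s; lra.
have : s / (s + B + 1) * B < s.
  by rewrite mulrAC ltr_pdivrMr // ltr_pM2l // /s; lra.
rewrite /s; nra.
Qed.

(** Test each of z and z' against the other and add: the values of [h] cancel, and the quadrilateral
    x, z, z', x' bounds the cross terms. *)
Lemma is_prox_nonexpansive (h : X -> \bar R) (x x' z z' : X) :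
  is_prox h x z -> is_prox h x' z' -> mdist z z' <= mdist x x'.
Proof.
move=> [r hz zP] [r' hz' zP'].
have := zP z' r'; rewrite hz' => /(_ (lexx _)) le1.
have := zP' z r; rewrite hz => /(_ (lexx _)) le2.
have quad := CAT0_quadrilateral X_CAT0 x z z' x'.
rewrite (metric_sym z' z) in le2; rewrite (metric_sym z x') (metric_sym z' x')
  (metric_sym x' x) in quad.
have : k * mdist z z' ^+ 2 <= k * mdist x x' ^+ 2.
  by have := ler_wpM2l (ltW k_gt0) quad; lra.
by rewrite ler_pM2l // ler_pXn2r ?nnegrE ?mdist_ge0.
Qed.

Lemma is_prox_unique (h : X -> \bar R) (x z z' : X) :
  is_prox h x z -> is_prox h x z' -> z = z'.
Proof.
move=> zP z'P; apply: mdist_positivity; apply/eqP; rewrite eq_le mdist_ge0.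
by rewrite andbT -[leRHS](mdistxx x) (is_prox_nonexpansive zP z'P).
Qed.

(* The point at distance 1 from p on the geodesic towards a remote x transfers
   the lower bound on the unit ball into a lower bound at x. *)
Lemma convex_fun_affine_minorant (h : X -> \bar R) (p q : X) (hp C : R) :
  convex_fun h -> h p = hp%:E ->
  (forall x, (C - k * mdist x q ^+ 2)%:E <= h x)%E ->
  exists2 K : R, 0 <= K & forall x, ((- (K * (1 + mdist p x)))%:E <= h x)%E.
Proof.
move=> h_cvx hpE h_ge.
pose M := C - k * (1 + mdist p q) ^+ 2.
have ball_ge x : mdist p x <= 1 -> (M%:E <= h x)%E.
  move=> px; apply: le_trans (h_ge x); rewrite lee_fin /M lerB //.
  rewrite ler_pM2l // lerXn2r ?nnegrE ?addr_ge0 ?mdist_ge0 //.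
  have := metric_triangle x p q; rewrite (metric_sym x p); lra.
have M0 := normr_ge0 M; have hp0 := normr_ge0 hp.
have := ler_norm hp; have := ler_norm (- M); rewrite normrN => M_le hp_le.
exists (`|M| + `|hp|); first by rewrite addr_ge0.
move=> x; have px0 := mdist_ge0 p x.
have [px|px] := leP (mdist p x) 1.
  apply: le_trans (ball_ge _ px); rewrite lee_fin; nra.
have [c cP] := X_CAT0.1 p x.
case hx : (h x) => [r||]; last 2 first.
- by rewrite leey.
- by have := h_ge x; rewrite hx.
pose t := (mdist p x)^-1.
have t01 : 0 <= t <= 1 by rewrite invr_ge0 px0 invf_le1 ?ltW //; lra.
have hct : (h (c t) <= ((1 - t) * hp + t * r)%:E)%E.
  by apply: convex_fun_le h_cvx cP t01 _ _; rewrite ?hpE ?hx.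
have d_t : mdist p x * t = 1 by rewrite mulfV // gt_eqF //; lra.
have /ball_ge Mct : mdist p (c t) <= 1.
  have [c0 _ cd] := cP; rewrite -{1}c0 cd // ?lexx ?ler01 //.
  by rewrite sub0r normrN ger0_norm ?invr_ge0 // mulrC d_t.
have := le_trans Mct hct; rewrite !lee_fin => /(ler_wpM2l px0).
have -> : mdist p x * ((1 - t) * hp + t * r) =
    (mdist p x - mdist p x * t) * hp + mdist p x * t * r by ring.
rewrite d_t; nra.
Qed.

Lemma prox_exists (h : X -> \bar R) (x p : X) (K : R) :
  complete_metric X -> convex_fun h -> lower_semicontinuous h -> proper_fun h ->
  0 <= K -> (forall z, (- (K * (1 + mdist p z)))%:E <= h z)%E ->
  exists z, unique (minimizer (fun y => (h y + (k * mdist x y ^+ 2)%:E)%E)) z.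
Proof.
move=> X_complete h_cvx h_lsc [y0 hy0] K0 h_ge.
have k_neq0 : k != 0 by rewrite gt_eqF.
(* With D = d(x, z), completing the square gives K D - k D^2 <= K^2 / (4 k), hence the lower bound.
   The modulus k / 4 is the t (1 - t) term of [CAT0_CN] at t = 1/2. *)
apply: (@strongly_midconvex_unique_minimizer _ _ _
  (- (K * (1 + mdist p x)) - K ^+ 2 / (4 * k)) (k / 4)) => //.
- by rewrite divr_gt0.
- move=> z; apply: le_trans (leeD2r _ (h_ge z)); rewrite -EFinD lee_fin.
  have tri := metric_triangle p x z; have D0 := mdist_ge0 x z.
  have : K * mdist x z <= K ^+ 2 / (4 * k) + k * mdist x z ^+ 2.
    rewrite -subr_ge0 (_ : _ - _ = k * (mdist x z - K / (2 * k)) ^+ 2).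
      by rewrite mulr_ge0 ?sqr_ge0 ?ltW.
    by field.
  have : K * mdist p z <= K * (mdist p x + mdist x z) by rewrite ler_wpM2l.
  lra.
- by exists y0; case: (h y0) hy0.
- apply: lower_semicontinuousD_cts => // y.
  by apply: cvgM; [exact: cvg_cst | apply: cvgM; exact: mdist_continuous].
- move=> a b ra rb Fa Fb; have [c cP] := X_CAT0.1 a b.
  have half01 : 0 <= (2^-1 : R) <= 1 by lra.
  rewrite -leeBrDr // -EFinB in Fa; rewrite -leeBrDr // -EFinB in Fb.
  have hc := convex_fun_le h_cvx cP half01 Fa Fb.
  exists (c 2^-1); apply: le_trans (leeD2r _ hc) _; rewrite -EFinD lee_fin.
  have := CAT0_CN X_CAT0 x cP half01 => /(ler_wpM2l (ltW k_gt0)); nra.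
Qed.

End proximal_points.

(** The quadratic minorant will come from [coupled_min_minorant]. It yields an affine one, hence a
    unique minimizer, so [xget] does not return its default. *)
Lemma resolvent_is_prox (R : realType) (X : metricType R) (h : X -> \bar R)
    (lam C : R) (q x : X) :
  complete_metric X -> CAT0 X -> (forall y, -oo < h y)%E -> convex_fun h ->
  lower_semicontinuous h -> proper_fun h -> 0 < lam ->
  (forall y, (C - (2 * lam)^-1 * mdist y q ^+ 2)%:E <= h y)%E ->
  is_prox (2 * lam)^-1 h x (resolvent h lam x).
Proof.
move=> X_complete X_CAT0 h_gtNy h_cvx h_lsc h_proper lam0 h_ge.
have k0 : 0 < (2 * lam)^-1 by rewrite invr_gt0 mulr_gt0.
have [p hp] := h_proper.
have hp_fin : h p \is a fin_num by rewrite fin_numElt h_gtNy ltey.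
have [K K0 hK] := convex_fun_affine_minorant X_CAT0 k0 h_cvx
  (esym (fineK hp_fin)) h_ge.
have ex := prox_exists X_CAT0 k0 x X_complete h_cvx h_lsc h_proper K0 hK.
have [z_min _] := xgetPex x ex.
exact: minimizer_is_prox z_min.
Qed.

(** * Real sequences and limits superior *)

Section real_sequences.
Context {R : realType}.
Implicit Types a e : nat -> R.

Lemma nneseries_cvgn_series e : (forall n, 0 <= e n) ->
  (\sum_(0 <= n <oo) (e n)%:E < +oo)%E -> cvgn (series e).
Proof.
move=> e0 e_sum; apply: nondecreasing_is_cvgn.
  apply/nondecreasing_seqP => n; rewrite seriesSr lerDl; exact: e0.
have s_fin : (\sum_(0 <= n <oo) (e n)%:E)%E \is a fin_num.
  by rewrite ge0_fin_numE // nneseries_ge0 // => n _ _; rewrite lee_fin.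
exists (fine (\sum_(0 <= n <oo) (e n)%:E)%E) => _ [n _ <-].
rewrite -lee_fin fineK // /series /= -sumEFin.
by apply: nneseries_lim_ge => i _ _; rewrite lee_fin.
Qed.

Lemma cvgn_series_shiftS e : cvgn (series e) ->
  cvgn (series (fun n => e n.+1)).
Proof.
move=> /cvg_ex[l el]; apply/cvg_ex; exists (l - e 0%N).
have -> : series (fun n => e n.+1) = (fun n => series e n.+1 - e 0%N).
  by apply/funext => n; rewrite /series /= big_nat_recl // addrAC subrr add0r.
by apply: cvgB; [rewrite (cvg_shiftS (series e)) | exact: cvg_cst].
Qed.

(** [a n - series e n] is nonincreasing and bounded below by minus the sum of [e]. *)
Lemma quasi_nonincreasing_is_cvgn a e : (forall n, 0 <= a n) ->
  (forall n, 0 <= e n) -> cvgn (series e) ->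
  (forall n, a n.+1 <= a n + e n) -> cvgn a.
Proof.
move=> a0 e0 se a_le.
have s_nd : nondecreasing_seq (series e).
  by apply/nondecreasing_seqP => n; rewrite seriesSr lerDl; exact: e0.
have as_cvg : cvgn (fun n => a n - series e n).
  apply: nonincreasing_is_cvgn.
    apply/nonincreasing_seqP => n; rewrite seriesSr; have := a_le n; lra.
  exists (- limn (series e)) => _ [n _ <-].
  have := nondecreasing_cvgn_le s_nd se n; have := a0 n; lra.
rewrite (_ : a = (fun n => a n - series e n) + series e).
  exact: is_cvgD.
by apply/funext => n; rewrite fctE subrK.
Qed.

Lemma limn_esup_le a (c : R) : (\forall n \near \oo, a n <= c) ->
  (limn_esup (fun n => (a n)%:E) <= c%:E)%E.
Proof.
move=> ac; apply: ge_ereal_inf.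
exists (ereal_sup [set (a n)%:E | n in [set n | a n <= c]]).
  by exists [set n | a n <= c].
by apply: ge_ereal_sup => _ [n /= an <-]; rewrite lee_fin.
Qed.

Lemma limn_esup_lt a (c : R) : (limn_esup (fun n => (a n)%:E) < c%:E)%E ->
  \forall n \near \oo, a n < c.
Proof.
move=> /ereal_inf_ltP[_ [V Voo <-] sup_lt]; apply: filterS Voo => n Vn.
rewrite -lte_fin; apply: le_lt_trans sup_lt.
by apply: ereal_sup_ubound; exists n.
Qed.

End real_sequences.

Lemma increasing_seq_cvgoo (phi : nat -> nat) :
  increasing_seq phi -> phi @ \oo --> \oo.
Proof.
move=> phi_inc; have phi_ge n : (n <= phi n)%N.
  elim: n => // n IHn; apply: leq_ltn_trans IHn _.
  by rewrite ltnNge; have := phi_inc n.+1 n; rewrite !leEnat => ->; rewrite -ltnNge.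
move=> A [N _ NA]; exists N => // n /= Nn; apply: NA => /=.
exact: leq_trans Nn (phi_ge n).
Qed.

Lemma ereal_inf_minimizer (R : realType) (T : Type) (F : T -> \bar R) (z : T) :
  F z = ereal_inf (range F) <-> minimizer F z.
Proof.
split=> [Fz y|z_min]; first by rewrite Fz; apply: ereal_inf_lbound; exists y.
apply/eqP; rewrite eq_le; apply/andP; split.
  by apply: le_ereal_inf_tmp => _ [y _ <-].
by apply: ereal_inf_lbound; exists z.
Qed.

(** * Asymptotic centers of bounded sequences *)

Section asymptotic_centers.
Context {R : realType} {X : metricType R}.
Implicit Types (u : nat -> X) (x y z : X).

Lemma bounded_sequence_comp u (phi : nat -> nat) :
  bounded_sequence u -> bounded_sequence (u \o phi).
Proof. by move=> [a [M uM]]; exists a, M => n /=. Qed.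

Lemma limsup_dist_fin_num u y :
  bounded_sequence u -> limsup_dist u y \is a fin_num.
Proof.
move=> [a [M uM]]; rewrite fin_numElt; apply/andP; split.
  apply: (@lt_le_trans _ _ (-1)%:E); first exact: ltNyr.
  rewrite leNgt; apply/negP => /limn_esup_lt lt_m1.
  by near \oo => n; have : mdist y (u n) < -1;
    [near: n | have := mdist_ge0 y (u n); lra].
apply: (@le_lt_trans _ _ (mdist y a + M)%:E); last exact: ltry.
apply: limn_esup_le; near=> n.
by apply: le_trans (metric_triangle y a (u n)) _; rewrite lerD2l.
Unshelve. all: by end_near. Qed.

Definition asymptotic_radius u y : R := fine (limsup_dist u y).

Lemma asymptotic_radiusK u y :
  bounded_sequence u -> (asymptotic_radius u y)%:E = limsup_dist u y.
Proof. by move=> /(limsup_dist_fin_num y) ?; rewrite fineK. Qed.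

Lemma near_asymptotic_radius u y (e : R) : bounded_sequence u -> 0 < e ->
  \forall n \near \oo, mdist y (u n) < asymptotic_radius u y + e.
Proof.
move=> u_bnd e0; apply: limn_esup_lt.
rewrite -/(limsup_dist u y) -asymptotic_radiusK // lte_fin; lra.
Qed.

Lemma asymptotic_radius_le u y (c : R) : bounded_sequence u ->
  (\forall n \near \oo, mdist y (u n) <= c) -> asymptotic_radius u y <= c.
Proof.
by move=> u_bnd uc; rewrite -lee_fin asymptotic_radiusK //; exact: limn_esup_le.
Qed.

Lemma asymptotic_radius_ge0 u y : bounded_sequence u -> 0 <= asymptotic_radius u y.
Proof.
move=> u_bnd; apply/ler_addgt0Pr => e e0.
near \oo => n; apply: le_trans (mdist_ge0 y (u n)) _; apply: ltW.
near: n; exact: near_asymptotic_radius.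
Unshelve. all: by end_near. Qed.

Lemma asymptotic_radius_lip u x y : bounded_sequence u ->
  asymptotic_radius u y <= asymptotic_radius u x + mdist x y.
Proof.
move=> u_bnd; apply/ler_addgt0Pr => e e0; apply: asymptotic_radius_le => //.
near=> n; have : mdist x (u n) < asymptotic_radius u x + e.
  by near: n; exact: near_asymptotic_radius.
have := metric_triangle y x (u n); rewrite (metric_sym y x); lra.
Unshelve. all: by end_near. Qed.

Lemma asymptotic_radius_continuous u : bounded_sequence u ->
  continuous (asymptotic_radius u).
Proof.
move=> u_bnd l; apply/cvgrPdist_lt => e e0.
apply: filterS (nbhsx_ballx l _ e0) => z; rewrite ballEmdist.
apply: le_lt_trans; have := asymptotic_radius_lip l z u_bnd.
have := asymptotic_radius_lip z l u_bnd; rewrite (metric_sym z l) ler_norml; lra.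
Qed.

Lemma asymptotic_radius_cvg u y (l : R) : bounded_sequence u ->
  mdist y (u n) @[n --> \oo] --> l -> asymptotic_radius u y = l.
Proof.
move=> u_bnd ul; apply: EFin_inj; rewrite asymptotic_radiusK //.
apply: (cvg_limn_einf_sup _).2; apply: cvg_EFin => //; exact: nearW.
Qed.

Lemma asymptotic_centerP u x : bounded_sequence u ->
  asymptotic_center u x <-> forall y, asymptotic_radius u x <= asymptotic_radius u y.
Proof.
move=> u_bnd; rewrite /asymptotic_center; apply: iff_trans (ereal_inf_minimizer _ _) _.
split=> xP y; last by rewrite -!asymptotic_radiusK // lee_fin.
by rewrite -lee_fin !asymptotic_radiusK.
Qed.

Hypothesis X_CAT0 : CAT0 X.

(** The midpoint inequality at [u n], passed to the limit superior: for each e > 0, [s e] eventually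
    bounds d(m, u n)^2; then e tends to 0. *)
Lemma asymptotic_radius_midpoint u x y : bounded_sequence u -> exists m,
  asymptotic_radius u m ^+ 2 <= (asymptotic_radius u x ^+ 2 +
    asymptotic_radius u y ^+ 2) / 2 - 4^-1 * mdist x y ^+ 2.
Proof.
move=> u_bnd; have [m mP] := CAT0_midpoint X_CAT0 x y; exists m.
set rx := asymptotic_radius u x; set ry := asymptotic_radius u y.
have rx0 : 0 <= rx := asymptotic_radius_ge0 x u_bnd.
have ry0 : 0 <= ry := asymptotic_radius_ge0 y u_bnd.
pose s e := ((rx + e) ^+ 2 + (ry + e) ^+ 2) / 2 - 4^-1 * mdist x y ^+ 2.
have s_ge e : 0 < e -> asymptotic_radius u m ^+ 2 <= s e.
  move=> e0.
  have um : \forall n \near \oo, mdist m (u n) ^+ 2 <= s e.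
    near=> n.
    have dx : mdist x (u n) < rx + e by near: n; exact: near_asymptotic_radius.
    have dy : mdist y (u n) < ry + e by near: n; exact: near_asymptotic_radius.
    have := mP (u n); rewrite !(metric_sym (u n)).
    have : mdist x (u n) ^+ 2 <= (rx + e) ^+ 2.
      by apply: lerXn2r; rewrite ?nnegrE ?mdist_ge0 ?addr_ge0 // ltW.
    have : mdist y (u n) ^+ 2 <= (ry + e) ^+ 2.
      by apply: lerXn2r; rewrite ?nnegrE ?mdist_ge0 ?addr_ge0 // ltW.
    rewrite /s; lra.
  have s0 : 0 <= s e.
    by near \oo => n; apply: le_trans (sqr_ge0 (mdist m (u n))) _; near: n.
  rewrite -(sqr_sqrtr s0); apply: lerXn2r;
    rewrite ?nnegrE ?sqrtr_ge0 ?asymptotic_radius_ge0 //.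
  apply: asymptotic_radius_le => //; apply: filterS um => n un.
  by rewrite -[leLHS]ger0_norm ?mdist_ge0 // -sqrtr_sqr ler_wsqrtr.
apply/ler_addgt0Pr => eps eps0.
(* As e <= 1, [s e] exceeds [s 0] by e (rx + ry) + e^2 <= e (rx + ry + 1) <= eps. *)
pose e := Num.min 1 (eps / (rx + ry + 1)).
have r1 : 0 < rx + ry + 1 by lra.
have e0 : 0 < e by rewrite lt_min ltr01 divr_gt0.
have e1 : e <= 1 by rewrite ge_min lexx.
have : e * (rx + ry + 1) <= eps.
  by rewrite -ler_pdivlMr // ge_min lexx orbT.
have := s_ge e e0; rewrite /s; clearbody e; nra.
Unshelve. all: by end_near. Qed.

Hypothesis X_complete : complete_metric X.

(** The squared radius has the same minimizers as the radius, is continuous, and is strongly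
    midconvex by [asymptotic_radius_midpoint]. *)
Lemma asymptotic_center_exists_unique u :
  bounded_sequence u -> exists x, unique (asymptotic_center u) x.
Proof.
move=> u_bnd; pose F y := (asymptotic_radius u y ^+ 2)%:E.
have FP x : minimizer F x <-> asymptotic_center u x.
  rewrite asymptotic_centerP //; split=> xP y; have := xP y;
    by rewrite /F lee_fin ler_pXn2r ?nnegrE ?asymptotic_radius_ge0.
have [x [x_min x_unique]] : exists x, unique (minimizer F) x.
  apply: (@strongly_midconvex_unique_minimizer _ _ F 0 4^-1) => //.
  - by move=> y; rewrite lee_fin sqr_ge0.
  - by have [a _] := u_bnd; exists a.
  - move=> l a; rewrite lte_fin => al.
    exists [set y | a < asymptotic_radius u y ^+ 2] => //.
    have /cvgr_gt : asymptotic_radius u y ^+ 2 @[y --> l]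
        --> asymptotic_radius u l ^+ 2.
      by apply: cvgM; exact: asymptotic_radius_continuous.
    exact.
  - move=> a b ra rb; rewrite !lee_fin => Fa Fb.
    have [m mP] := asymptotic_radius_midpoint a b u_bnd.
    exists m; rewrite lee_fin; lra.
exists x; split=> [|y]; first exact/FP.
by move=> /FP; exact: x_unique.
Qed.

(** Since d(T x, u n) <= d(x, u n) + d(u n, T (u n)), the radius at T x is at most that at x; so T x
    is a center too, and centers are unique. *)
Lemma asymptotic_center_fixed u (T : X -> X) x : bounded_sequence u ->
  (forall y z, mdist (T y) (T z) <= mdist y z) ->
  mdist (u n) (T (u n)) @[n --> \oo] --> 0 ->
  asymptotic_center u x -> T x = x.
Proof.
move=> u_bnd T_ne u_reg x_cent.
have [x' [_ x'_unique]] := asymptotic_center_exists_unique u_bnd.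
rewrite -(x'_unique x x_cent); apply/esym/x'_unique.
apply/asymptotic_centerP => // y.
apply: le_trans ((asymptotic_centerP x u_bnd).1 x_cent y).
rewrite -(x'_unique x x_cent).
apply/ler_addgt0Pr => e e0; apply: asymptotic_radius_le => //.
have e2 : 0 < e / 2 by lra.
near=> n.
have : mdist x' (u n) < asymptotic_radius u x' + e / 2.
  by near: n; exact: near_asymptotic_radius.
have : mdist (u n) (T (u n)) < e / 2 by near: n; exact: (cvgr_lt _ u_reg).
have := metric_triangle (T x') (T (u n)) (u n); have := T_ne x' (u n).
rewrite (metric_sym (T (u n))); lra.
Unshelve. all: by end_near. Qed.

(** * Orbits of a nonexpansive map up to summable errors *)

Section inexact_orbits.
Context (T : X -> X) (u : nat -> X) (e : nat -> R).
Hypothesis T_ne : forall y z, mdist (T y) (T z) <= mdist y z.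
Hypothesis e_sum : cvgn (series e).
Hypothesis u_orbit : forall n, mdist (u n.+1) (T (u n)) <= e n.

Lemma inexact_orbit_dist_cvg p : T p = p -> cvgn (fun n => mdist p (u n)).
Proof.
move=> Tp; apply: (@quasi_nonincreasing_is_cvgn _ _ e) => // n;
  rewrite ?mdist_ge0 //.
  exact: le_trans (mdist_ge0 _ _) (u_orbit n).
have := metric_triangle p (T (u n)) (u n.+1); have := T_ne p (u n).
have := u_orbit n; rewrite (metric_sym (u n.+1)) Tp; lra.
Qed.

Lemma inexact_orbit_bounded p : T p = p -> bounded_sequence u.
Proof.
move=> /inexact_orbit_dist_cvg /cvg_seq_bounded.
move=> [M [_ /(_ (M + 1))]]; rewrite ltrDl ltr01 => /(_ isT) uM.
exists p, (M + 1) => n; apply: le_trans (uM n I) => /=; exact: ler_norm.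
Qed.

(* Along the whole sequence, the distance to a fixed point converges, so the
   radius of a subsequence at a fixed point is that of the full sequence; hence
   no subsequence can have a center other than that of u. *)
Lemma Delta_cvg_inexact_orbit p : T p = p ->
  mdist (u n) (T (u n)) @[n --> \oo] --> 0 -> exists2 z, T z = z & Delta_cvg u z.
Proof.
move=> Tp u_reg; have u_bnd := inexact_orbit_bounded Tp.
have [z [z_cent z_unique]] := asymptotic_center_exists_unique u_bnd.
have Tz := asymptotic_center_fixed u_bnd T_ne u_reg z_cent.
exists z => //; split=> // phi phi_inc.
have phi_oo := increasing_seq_cvgoo phi_inc.
have v_bnd := bounded_sequence_comp phi u_bnd.
have radius_eq w : T w = w ->
    asymptotic_radius (u \o phi) w = asymptotic_radius u w.
  move=> Tw; have wu := inexact_orbit_dist_cvg Tw.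
  rewrite (asymptotic_radius_cvg u_bnd wu); apply: asymptotic_radius_cvg => //.
  exact: cvg_comp phi_oo wu.
have [w [w_cent w_unique]] := asymptotic_center_exists_unique v_bnd.
have Tw : T w = w.
  apply: asymptotic_center_fixed v_bnd T_ne _ w_cent.
  exact: cvg_comp phi_oo u_reg.
suff -> : z = w by [].
apply/esym/w_unique/asymptotic_centerP => // y.
apply: le_trans ((asymptotic_centerP w v_bnd).1 w_cent y).
rewrite !radius_eq //; exact: (asymptotic_centerP z u_bnd).1.
Qed.

(** As [T (u n)] is within [e n] of [u n.+1], d(p, u n) and d(p, T (u n)) have the same limit, so
    the first hypothesis forces d(T (u n), T (T (u n))) to 0. *)
Lemma inexact_orbit_regular p :
  (forall x, mdist (T x) (T (T x)) ^+ 2 <= mdist p x ^+ 2 - mdist p (T x) ^+ 2) ->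
  T p = p -> mdist (u n) (T (u n)) @[n --> \oo] --> 0.
Proof.
move=> T_reg Tp; have /cvg_ex[l ul] := inexact_orbit_dist_cvg Tp.
have e0 : e @ \oo --> 0 by exact: cvg_series_cvg_0.
have uSl : mdist p (u n.+1) @[n --> \oo] --> l.
  by rewrite (cvg_shiftS (fun n => mdist p (u n))).
have Tul : mdist p (T (u n)) @[n --> \oo] --> l.
  apply: (@squeeze_cvgr _ _ _ _ (fun n => mdist p (u n.+1) - e n)
    (fun n => mdist p (u n.+1) + e n)).
  - near=> n; have := metric_triangle p (u n.+1) (T (u n)).
    have := metric_triangle p (T (u n)) (u n.+1); have := u_orbit n.
    rewrite (metric_sym (T (u n)) (u n.+1)); lra.
  - by rewrite -[l]subr0; apply: cvgB.
  - by rewrite -[l]addr0; apply: cvgD.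
have sqrt0 : Num.sqrt (mdist p (u n) ^+ 2 - mdist p (T (u n)) ^+ 2)
    @[n --> \oo] --> (0 : R).
  rewrite -(@sqrtr0 R) -(subrr (l ^+ 2)).
  apply: (@continuous_cvg _ _ _ _ _ _ (@Num.sqrt R)); first exact: sqrt_continuous.
  by apply: cvgB; apply: cvgM.
(* At index n + 1 the error [e n] enters twice: between [u n.+1] and [T (u n)], and between their
   images under T. *)
rewrite -(cvg_shiftS (fun n => mdist (u n) (T (u n)))) /=.
apply: (@squeeze_cvgr _ _ _ _ (fun=> 0) (fun n => e n + e n +
  Num.sqrt (mdist p (u n) ^+ 2 - mdist p (T (u n)) ^+ 2))).
- near=> n; rewrite mdist_ge0 /=.
  have := ler_wsqrtr (T_reg (u n)); rewrite sqrtr_sqr ger0_norm ?mdist_ge0 //.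
  have := metric_triangle (u n.+1) (T (u n)) (T (u n.+1)).
  have := metric_triangle (T (u n)) (T (T (u n))) (T (u n.+1)).
  have := T_ne (T (u n)) (u n.+1); have := u_orbit n.
  rewrite (metric_sym (T (u n)) (u n.+1)); lra.
- exact: cvg_cst.
- by rewrite -[0]addr0 -[X in X + 0]addr0; apply: cvgD => //; exact: cvgD.
Unshelve. all: by end_near. Qed.

End inexact_orbits.
End asymptotic_centers.

(** * Alternating resolvents and minimizers of Phi *)

Section alternating_proximal_maps.
Context {R : realType} {X : metricType R}.
Hypothesis X_CAT0 : CAT0 X.
Context (k : R).
Hypothesis k_gt0 : 0 < k.
Implicit Types f g : X -> \bar R.

(* (p, q) minimizes f(x) + g(y) + k d(x, y)^2, with finite value; stated over R to
   keep extended-real arithmetic out of the estimates. *)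
Definition coupled_min f g (p q : X) (fp gq : R) :=
  [/\ f p = fp%:E, g q = gq%:E &
    forall (a b : X) (ra rb : R), (f a <= ra%:E)%E -> (g b <= rb%:E)%E ->
      fp + gq + k * mdist p q ^+ 2 <= ra + rb + k * mdist a b ^+ 2].

Lemma coupled_minC f g p q fp gq :
  coupled_min f g p q fp gq -> coupled_min g f q p gq fp.
Proof.
move=> [fpE gqE min]; split=> // a b ra rb ga fb.
have := min b a rb ra fb ga; rewrite (metric_sym p q) (metric_sym b a); lra.
Qed.

(** Test minimality against the pair (y, q). *)
Lemma coupled_min_minorant f g p q fp gq y :
  (forall x, -oo < f x)%E -> coupled_min f g p q fp gq ->
  ((fp + k * mdist p q ^+ 2 - k * mdist y q ^+ 2)%:E <= f y)%E.
Proof.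
move=> f_gtNy [_ gqE min]; case fy : (f y) => [r||].
- have := min y q r gq; rewrite fy gqE => /(_ (lexx _) (lexx _)).
  rewrite lee_fin; lra.
- exact: leey.
- by have := f_gtNy y; rewrite fy.
Qed.

Lemma coupled_min_is_prox f g p q fp gq :
  (forall x, -oo < f x)%E -> convex_fun f -> coupled_min f g p q fp gq ->
  is_prox k f q p.
Proof.
move=> f_gtNy f_cvx pq; have [fpE _ _] := pq.
apply: minimizer_is_prox => //; first by exists p; rewrite fpE.
move=> y; rewrite fpE; have := coupled_min_minorant y f_gtNy pq.
rewrite (metric_sym q p) (metric_sym q y).
by rewrite EFinB leeBlDr.
Qed.

(** Add the variational inequalities at u and v; the quadrilateral a, b, v, u replaces the diagonals
    d(a, v) and d(b, u) by d(a, b) and terms that cancel. *)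
Lemma is_prox_coupled_min f g (u v : X) :
  is_prox k g u v -> is_prox k f v u -> exists fu gv, coupled_min f g u v fu gv.
Proof.
move=> [gv gvE vP] [fu fuE uP]; exists fu, gv; split=> // a b ra rb fa gb.
have := vP b rb gb; have := uP a ra fa.
have := ler_wpM2l (ltW k_gt0) (CAT0_quadrilateral X_CAT0 a b v u).
rewrite (metric_sym a v) (metric_sym b u) (metric_sym b v) (metric_sym v u).
lra.
Qed.

Context (f g : X -> \bar R) (Jf Jg : X -> X).
Hypothesis JfP : forall x, is_prox k f x (Jf x).
Hypothesis JgP : forall x, is_prox k g x (Jg x).

Lemma alternating_prox_nonexpansive x y :
  mdist (Jf (Jg x)) (Jf (Jg y)) <= mdist x y.
Proof.
apply: le_trans (is_prox_nonexpansive X_CAT0 k_gt0 (JfP _) (JfP _)) _.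
exact: (is_prox_nonexpansive X_CAT0 k_gt0 (JgP _) (JgP _)).
Qed.

(* With b = Jg x and a = Jf b, the values at (a, b) and (a, Jg a) are squeezed
   between the minimum and the minimum plus k (d(p, x)^2 - d(p, a)^2). *)
Lemma alternating_prox_regular p q fp gq x : coupled_min f g p q fp gq ->
  mdist (Jf (Jg x)) (Jf (Jg (Jf (Jg x)))) ^+ 2
    <= mdist p x ^+ 2 - mdist p (Jf (Jg x)) ^+ 2.
Proof.
move=> [fpE gqE min].
set b := Jg x; set a := Jf b; set b' := Jg a.
have ab : mdist a (Jf b') <= mdist b b'.
  exact: (is_prox_nonexpansive X_CAT0 k_gt0 (JfP _) (JfP _)).
have ab2 : mdist a (Jf b') ^+ 2 <= mdist b b' ^+ 2.
  by apply: lerXn2r; rewrite ?nnegrE ?mdist_ge0.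
apply: le_trans ab2 _.
have [gb gbE bP] := JgP x; have [fa faE aP] := JfP b; have [gb' gb'E b'P] := JgP a.
(* [le1], [le2] and the quadrilateral x, b, q, p bound the value at (a, b) from above; by [le3]
   passing to (a, b') lowers it by at least k d(b, b')^2; [le4] bounds the result below by the
   minimum. *)
have le1 := bP q gq; rewrite gqE in le1.
have le2 := aP p fp; rewrite fpE in le2.
have le3 := b'P b gb; rewrite gbE in le3.
have le4 := min a b' fa gb'; rewrite faE gb'E in le4.
move: (le1 (lexx _)) (le2 (lexx _)) (le3 (lexx _)) (le4 (lexx _) (lexx _)).
have := ler_wpM2l (ltW k_gt0) (CAT0_quadrilateral X_CAT0 x b q p).
rewrite -/b -/a -/b' (metric_sym q p) (metric_sym b' b) (metric_sym b a) (metric_sym a p).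
move=> q1 q2 q3 q4 q5.
by rewrite -(ler_pM2l k_gt0); lra.
Qed.

Lemma Delta_cvg_alternating_prox p q fp gq (u : nat -> X) (e : nat -> R) :
  complete_metric X -> coupled_min f g p q fp gq -> Jf (Jg p) = p ->
  cvgn (series e) -> (forall n, mdist (u n.+1) (Jf (Jg (u n))) <= e n) ->
  exists2 z, Jf (Jg z) = z & Delta_cvg u z.
Proof.
move=> X_complete pq Tp e_sum u_orbit.
have T_ne := alternating_prox_nonexpansive.
apply: (Delta_cvg_inexact_orbit X_CAT0 X_complete (T := Jf \o Jg)
  T_ne e_sum u_orbit Tp).
apply: (inexact_orbit_regular (T := Jf \o Jg) T_ne e_sum u_orbit _ Tp) => x.
exact: alternating_prox_regular pq.
Qed.

End alternating_proximal_maps.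

(** * The two limits and their identification *)

Unset Implicit Arguments.

Theorem corollary4p5 (R : realType) (X : metricType R)
    (X_complete : complete_metric X) (X_CAT0 : CAT0 X)
    (f g : X -> \bar R)
    (f_gtNy : forall x, (-oo < f x)%E) (f_convex : convex_fun f)
    (f_lsc : lower_semicontinuous f) (f_proper : proper_fun f)
    (g_gtNy : forall x, (-oo < g x)%E) (g_convex : convex_fun g)
    (g_lsc : lower_semicontinuous g) (g_proper : proper_fun g)
    (lam : R) (lam_gt0 : 0 < lam) :
  let Phi (p : X * X) : \bar R :=
    (f p.1 + g p.2 + ((2 * lam)^-1 * mdist p.1 p.2 ^+ 2)%:E)%E in
  (exists p : X * X, minimizer Phi p) ->
  forall (eps delta : nat -> R),
  (forall n, 0 <= eps n) -> (forall n, 0 <= delta n) ->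
  (\sum_(0 <= n <oo) (eps n)%:E < +oo)%E ->
  (\sum_(0 <= n <oo) (delta n)%:E < +oo)%E ->
  forall (x0 : X) (x y : nat -> X),
  x 0%N = x0 ->
  (forall n, mdist (y n) (resolvent g lam (x n)) <= eps n) ->
  (forall n, mdist (x n.+1) (resolvent f lam (y n)) <= delta n) ->
  exists u : X,
    [/\ minimizer Phi (u, resolvent g lam u),
        Delta_cvg x u & Delta_cvg y (resolvent g lam u)].
Proof.
move=> Phi [[p q] pq_min] eps delta eps0 delta0 eps_sum delta_sum x0 x y _ y_le x_le.
set k := (2 * lam)^-1 in Phi pq_min *.
have k_gt0 : 0 < k by rewrite invr_gt0 mulr_gt0.
have [fp [gq pq]] : exists fp gq, coupled_min k f g p q fp gq.
  (* Points where [f] and [g] are finite show that the minimum is finite. *)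
  have [[a fa] [b gb]] := (f_proper, g_proper).
  have : (Phi (p, q) < +oo)%E.
    apply: le_lt_trans (pq_min (a, b)) _.
    by rewrite !lte_add_pinfty ?ltry ?ltey.
  have := f_gtNy p; have := g_gtNy q; rewrite /Phi /=.
  case gqE : (g q) => [gq||//] _; case fpE : (f p) => [fp||//] _ //.
  move=> _; exists fp, gq; split=> // a' b' ra rb fa' gb'.
  rewrite -lee_fin !EFinD -fpE -gqE; apply: le_trans (pq_min (a', b')) _.
  by rewrite /Phi /= leeD2r // leeD.
have qp := coupled_minC pq.
pose Jf := resolvent f lam; pose Jg := resolvent g lam.
have JfP z : is_prox k f z (Jf z).
  apply: (resolvent_is_prox (q := q)) => // w; exact: coupled_min_minorant pq.
have JgP z : is_prox k g z (Jg z).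
  apply: (resolvent_is_prox (q := p)) => // w; exact: coupled_min_minorant qp.
have pE : Jf q = p.
  exact: (is_prox_unique X_CAT0 k_gt0 (JfP q)
    (coupled_min_is_prox X_CAT0 k_gt0 f_gtNy f_convex pq)).
have qE : Jg p = q.
  exact: (is_prox_unique X_CAT0 k_gt0 (JgP p)
    (coupled_min_is_prox X_CAT0 k_gt0 g_gtNy g_convex qp)).
have {}eps_sum := nneseries_cvgn_series eps0 eps_sum.
have {}delta_sum := nneseries_cvgn_series delta0 delta_sum.
have x_orbit n : mdist (x n.+1) (Jf (Jg (x n))) <= eps n + delta n.
  have := metric_triangle (x n.+1) (Jf (y n)) (Jf (Jg (x n))).
  have := is_prox_nonexpansive X_CAT0 k_gt0 (JfP (y n)) (JfP (Jg (x n))).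
  have := x_le n; have := y_le n; rewrite -/Jf -/Jg; lra.
(* The step from y n to y (n + 1) passes through x (n + 1), hence the shifted index of [eps]. *)
have y_orbit n : mdist (y n.+1) (Jg (Jf (y n))) <= eps n.+1 + delta n.
  have := metric_triangle (y n.+1) (Jg (x n.+1)) (Jg (Jf (y n))).
  have := is_prox_nonexpansive X_CAT0 k_gt0 (JgP (x n.+1)) (JgP (Jf (y n))).
  have := x_le n; have := y_le n.+1; rewrite -/Jf -/Jg; lra.
have x_sum : cvgn (series (fun n => eps n + delta n)).
  exact: is_cvg_seriesD eps_sum delta_sum.
have y_sum : cvgn (series (fun n => eps n.+1 + delta n)).
  exact: is_cvg_seriesD (cvgn_series_shiftS eps_sum) delta_sum.
have Tp : Jf (Jg p) = p by rewrite qE pE.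
have Sq : Jg (Jf q) = q by rewrite pE qE.
have [u Tu xu] := Delta_cvg_alternating_prox X_CAT0 k_gt0 JfP JgP X_complete
  pq Tp x_sum x_orbit.
have [v Sv yv] := Delta_cvg_alternating_prox X_CAT0 k_gt0 JgP JfP X_complete
  qp Sq y_sum y_orbit.
exists u; split=> //.
  have [fu [gv [fuE gvE uv_min]]] :
      exists fu gv, coupled_min k f g u (Jg u) fu gv.
    apply: (is_prox_coupled_min X_CAT0 k_gt0 (JgP u)); rewrite -{2}Tu; exact: JfP.
  move=> [a b]; rewrite /Phi /= -/Jg fuE gvE.
  move: (f_gtNy a) (g_gtNy b) (uv_min a b).
  case: (f a) => [ra||//] _; case: (g b) => [rb||//] _ h; rewrite ?leey //.
  by rewrite -!EFinD lee_fin; exact: h.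
rewrite -/Jg; suff -> : u = Jf v by rewrite Sv.
(* For a fixed point z of Jf Jg, d(x_n, z) and d(y_n, Jg z) have the same limit,
   so optimality of v for y makes Jf v an asymptotic center of x. *)
have radius_eq z : Jf (Jg z) = z ->
    asymptotic_radius x z = asymptotic_radius y (Jg z).
  move=> Tz; have T_ne := alternating_prox_nonexpansive X_CAT0 k_gt0 JfP JgP.
  have /cvg_ex[l xl] : cvgn (fun n => mdist z (x n)).
    exact: (inexact_orbit_dist_cvg (T := Jf \o Jg) T_ne x_sum x_orbit Tz).
  rewrite (asymptotic_radius_cvg xu.1 xl); apply/esym/asymptotic_radius_cvg.
    exact: yv.1.
  (* Nonexpansiveness of [Jg] gives the upper bound; that of [Jf], with Jf (Jg z) = z, gives the
     lower one, at index n + 1. *)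
  apply: (@squeeze_cvgr _ _ _ _ (fun n => mdist z (x n.+1) - delta n)
    (fun n => mdist z (x n) + eps n)).
  - near=> n; have := metric_triangle z (Jf (y n)) (x n.+1).
    have := metric_triangle (Jg z) (Jg (x n)) (y n).
    have := is_prox_nonexpansive X_CAT0 k_gt0 (JgP z) (JgP (x n)).
    have := is_prox_nonexpansive X_CAT0 k_gt0 (JfP (Jg z)) (JfP (y n)).
    have := x_le n; have := y_le n; rewrite -/Jf -/Jg Tz.
    rewrite (metric_sym (Jg (x n)) (y n)) (metric_sym (Jf (y n)) (x n.+1)); lra.
  - rewrite -[l]subr0; apply: cvgB; last exact: cvg_series_cvg_0.
    by rewrite (cvg_shiftS (fun n => mdist z (x n))).
  - by rewrite -[l]addr0; apply: cvgD => //; exact: cvg_series_cvg_0.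
have [x_cent x_unique] := xu.2 id (fun _ _ => erefl).
have [y_cent _] := yv.2 id (fun _ _ => erefl).
apply: x_unique; apply/(asymptotic_centerP _ xu.1) => w.
have Tv : Jf (Jg (Jf v)) = Jf v by rewrite Sv.
(* With r_x and r_y the radii: r_x(Jf v) = r_y(v) <= r_y(Jg u) = r_x(u) <= r_x(w). *)
rewrite (radius_eq _ Tv) Sv.
apply: le_trans ((asymptotic_centerP v yv.1).1 y_cent (Jg u)) _.
rewrite -(radius_eq _ Tu); exact: (asymptotic_centerP u xu.1).1 x_cent w.
Unshelve. all: by end_near. Qed.
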